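(* Let $S: z=z(u,v)$, $(u,v)\in\mathcal D$, be a space-like W-surface in $\mathbb R^3_1$ with unit normal field $l$, and let $(u,v)$ be natural principal parameters of $S$. Then $(u,v)$ are natural principal parameters for all parallel space-like surfaces $\bar S(a):\ \bar z(u,v)=z(u,v)+a\,l(u,v)$, $a=\mathrm{const}\neq0$, of $S$.
   Context: $\mathbb R^3_1$ is three-dimensional Minkowski space with flat metric of signature $(2,1)$. All functions are assumed smooth; $\mathcal D\subset\mathbb R^2$ is a domain. A surface is space-like if its induced metric is positive definite; its unit normal $l$ satisfies $l^2=-1$. Put $E=z_u^2$, $F=z_uz_v$, $G=z_v^2$, $L=lz_{uu}$, $M=lz_{uv}$, $N=lz_{vv}$. Surfaces are free of umbilical points; $(u,v)$ are principal parameters if $F=M=0$, and then the principal curvatures are $\nu_1=L/E$, $\nu_2=N/G$. A space-like surface is a W-surface (Weingarten surface) if there are differentiable functions $f,g$ on an interval $\mathcal I$ and a differentiable function $\nu=\nu(u,v)\in\mathcal I$ such that $f'g'\neq0$, $f-g\neq0$, $\nu_1=f(\nu)$, $\nu_2=g(\nu)$. For fixed $\nu_0\in\mathcal I$ put $I=\int_{\nu_0}^{\nu}\frac{f'\,d\nu}{f-g}$, $J=\int_{\nu_0}^{\nu}\frac{g'\,d\nu}{g-f}$. Principal parameters $(u,v)$ on a W-surface are natural principal if the functions $\sqrt E\,e^{I}$ and $\sqrt G\,e^{J}$ are both constant. For the parallel surface $\bar S(a)$ the points where $(1-a\nu_1)(1-a\nu_2)=0$ are excluded; on the remaining part (restricted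 to a connected piece) $\bar S(a)$ is space-like with unit normal $\bar l=\varepsilon l$, $\varepsilon=\mathrm{sign}\,(1-a\nu_1)(1-a\nu_2)$, and its W-surface structure is taken with respect to this normal. *)

(* Defs.v *)
From Stdlib Require Import Reals.
From Coquelicot Require Import Coquelicot.
Open Scope R_scope.

(** ** Plane domains and smoothness *)

Definition connected (D : R * R -> Prop) : Prop :=
  forall U V : R * R -> Prop, open U -> open V ->
    (forall p, D p -> U p \/ V p) ->
    (forall p, D p -> U p -> V p -> False) ->
    (forall p, D p -> U p) \/ (forall p, D p -> V p).

Definition is_domain (D : R * R -> Prop) : Prop :=
  open D /\ connected D /\ exists p, D p.

(* [ex_diff_n h n] asks for all iterated partial derivatives up to order [n],
   all of them continuous; on an open set [D] this is the class C^infinity. *)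
Definition smooth2 (D : R * R -> Prop) (h : R -> R -> R) : Prop :=
  forall u v, D (u, v) -> forall n, ex_diff_n h n u v.

(* The interval may be open or contain its end points, but is not a single
   point, so that derivatives of functions on it make sense. *)
Definition is_interval (I : R -> Prop) : Prop :=
  (forall x y t, I x -> I y -> x <= t <= y -> I t) /\
  (exists x y, I x /\ I y /\ x < y).

(* Smoothness on a possibly non-open set: the function is C^infinity on a
   neighbourhood of each of its points. *)
Definition smooth1 (I : R -> Prop) (h : R -> R) : Prop :=
  forall x, I x -> locally x (fun y => forall n, ex_derive_n h n y).

(** ** Minkowski 3-space *)

Definition R31 : Type := (R * R * R)%type.

Definition c1 (x : R31) : R := fst (fst x).
Definition c2 (x : R31) : R := snd (fst x).
Definition c3 (x : R31) : R := snd x.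

Definition add31 (x y : R31) : R31 := (c1 x + c1 y, c2 x + c2 y, c3 x + c3 y).
Definition scal31 (k : R) (x : R31) : R31 := (k * c1 x, k * c2 x, k * c3 x).

Definition mdot (x y : R31) : R := c1 x * c1 y + c2 x * c2 y - c3 x * c3 y.

Definition smooth_map (D : R * R -> Prop) (w : R -> R -> R31) : Prop :=
  smooth2 D (fun u v => c1 (w u v)) /\
  smooth2 D (fun u v => c2 (w u v)) /\
  smooth2 D (fun u v => c3 (w u v)).

Definition Du (w : R -> R -> R31) : R -> R -> R31 := fun u v =>
  (Derive (fun t => c1 (w t v)) u,
   Derive (fun t => c2 (w t v)) u,
   Derive (fun t => c3 (w t v)) u).

Definition Dv (w : R -> R -> R31) : R -> R -> R31 := fun u v =>
  (Derive (fun t => c1 (w u t)) v,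
   Derive (fun t => c2 (w u t)) v,
   Derive (fun t => c3 (w u t)) v).

(** ** Space-like surfaces *)

Section Surface.

Variables (z l : R -> R -> R31).

Definition coefE (u v : R) : R := mdot (Du z u v) (Du z u v).
Definition coefF (u v : R) : R := mdot (Du z u v) (Dv z u v).
Definition coefG (u v : R) : R := mdot (Dv z u v) (Dv z u v).

Definition coefL (u v : R) : R := mdot (l u v) (Du (Du z) u v).
Definition coefM (u v : R) : R := mdot (l u v) (Dv (Du z) u v).
Definition coefN (u v : R) : R := mdot (l u v) (Dv (Dv z) u v).

Definition spacelike_at (u v : R) : Prop :=
  forall x y, (x, y) <> (0, 0) ->
    0 < coefE u v * x ^ 2 + 2 * coefF u v * x * y + coefG u v * y ^ 2.

Definition unit_normal_at (u v : R) : Prop :=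
  mdot (l u v) (Du z u v) = 0 /\
  mdot (l u v) (Dv z u v) = 0 /\
  mdot (l u v) (l u v) = -1.

Definition umbilical_at (u v : R) : Prop :=
  exists k, coefL u v = k * coefE u v /\
            coefM u v = k * coefF u v /\
            coefN u v = k * coefG u v.

Definition spacelike_surface (D : R * R -> Prop) : Prop :=
  smooth_map D z /\ smooth_map D l /\
  forall u v, D (u, v) ->
    spacelike_at u v /\ unit_normal_at u v /\ ~ umbilical_at u v.

Definition principal_parameters (D : R * R -> Prop) : Prop :=
  forall u v, D (u, v) -> coefF u v = 0 /\ coefM u v = 0.

(* The principal curvatures, provided that the parameters are principal. *)
Definition nu1 (u v : R) : R := coefL u v / coefE u v.
Definition nu2 (u v : R) : R := coefN u v / coefG u v.

(** ** Weingarten surfaces in principal parameters *)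

Definition W_structure (D : R * R -> Prop)
    (I : R -> Prop) (f g : R -> R) (nu : R -> R -> R) : Prop :=
  is_interval I /\ smooth1 I f /\ smooth1 I g /\
  (forall x, I x -> Derive f x * Derive g x <> 0 /\ f x - g x <> 0) /\
  smooth2 D nu /\
  (forall u v, D (u, v) ->
     I (nu u v) /\ nu1 u v = f (nu u v) /\ nu2 u v = g (nu u v)).

Definition W_surface (D : R * R -> Prop) : Prop :=
  exists I f g nu, W_structure D I f g nu.

Definition intI (f g : R -> R) (x0 x : R) : R :=
  RInt (fun t => Derive f t / (f t - g t)) x0 x.
Definition intJ (f g : R -> R) (x0 x : R) : R :=
  RInt (fun t => Derive g t / (g t - f t)) x0 x.

Definition natural_principal_parameters (D : R * R -> Prop)
    (f g : R -> R) (nu : R -> R -> R) (x0 : R) : Prop :=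
  principal_parameters D /\
  (exists c, forall u v, D (u, v) ->
     sqrt (coefE u v) * exp (intI f g x0 (nu u v)) = c) /\
  (exists c, forall u v, D (u, v) ->
     sqrt (coefG u v) * exp (intJ f g x0 (nu u v)) = c).

(** ** Parallel surfaces *)

Definition parallel_surface (a : R) (u v : R) : R31 :=
  add31 (z u v) (scal31 a (l u v)).

Definition parallel_factor (a : R) (u v : R) : R :=
  (1 - a * nu1 u v) * (1 - a * nu2 u v).

Definition parallel_normal (a : R) (u v : R) : R31 :=
  scal31 (sign (parallel_factor a u v)) (l u v).

End Surface.

(* Main.v *)
From Stdlib Require Import Reals Lra Lia.
From Coquelicot Require Import Coquelicot.
Require Import Defs.
Open Scope R_scope.

(** In principal parameters the derivatives of the normal are
    [l_u = - nu1 z_u] and [l_v = - nu2 z_v] (Rodrigues' formulas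
    [Rodrigues_u], [Rodrigues_v]). Hence the parallel surface has the partial
    derivatives [(1 - a nu1) z_u] and [(1 - a nu2) z_v]. Its parameters are
    again principal, its coefficients [E] and [G] are those of the given surface
    multiplied by [(1 - a nu1) ^ 2] and [(1 - a nu2) ^ 2], and, with [e] the
    sign of [(1 - a nu1) (1 - a nu2)], which is constant on a connected piece,
    its principal curvatures are [e nu_i / (1 - a nu_i)]
    ([parallel_principal_curvatures]).

    Consequently the functions [e f / (1 - a f)] and [e g / (1 - a g)], with the
    same [nu], make the parallel surface a W-surface. They have to be restricted
    to an interval on which the denominators do not vanish; such an interval
    containing the values of [nu] exists because these values form a connected
    set that avoids the zeros of the denominators ([parallel_W_surface]).

    For the natural parameters the W-structure of the parallel surface is
    arbitrary, so the required functions are shown to be constant by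
    differentiating them along the coordinate lines. Replacing [sqrt E] of the
    given surface by a constant multiple of [exp (- intI)], the derivative
    vanishes by an identity between rational functions in [f] and [g]
    ([parallel_weight_derive]); exchanging [f] and [g] gives the statement for
    [sqrt G]. A function with vanishing partial derivatives on a domain is
    constant ([zero_partials_const]). *)

(** * Functions on plane domains *)

Lemma open_locally_2d (D : R * R -> Prop) (u v : R) :
  open D -> D (u, v) -> locally_2d (fun x y => D (x, y)) u v.
Proof.
  intros oD Duv. apply locally_2d_locally.
  apply filter_imp with (2 := oD _ Duv). now intros [x y] H.
Qed.

Lemma open_locally_u (D : R * R -> Prop) (u v : R) :
  open D -> D (u, v) -> locally u (fun x => D (x, v)).
Proof.
  intros oD Duv.
  exact (locally_2d_1d_const_y _ _ _ (open_locally_2d D u v oD Duv)).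
Qed.

Lemma open_locally_v (D : R * R -> Prop) (u v : R) :
  open D -> D (u, v) -> locally v (fun y => D (u, y)).
Proof.
  intros oD Duv.
  exact (locally_2d_1d_const_x _ _ _ (open_locally_2d D u v oD Duv)).
Qed.

(** Intermediate value theorem on a domain: a value that is not attained
    separates the image. *)
Lemma domain_value_separates (D : R * R -> Prop) (h : R -> R -> R) (t : R) :
  is_domain D ->
  (forall u v, D (u, v) -> continuity_2d_pt h u v) ->
  (forall u v, D (u, v) -> h u v <> t) ->
  (forall u v, D (u, v) -> h u v < t) \/ (forall u v, D (u, v) -> t < h u v).
Proof.
  intros [oD [cD _]] ch nt.
  destruct (cD (fun p => D p /\ h (fst p) (snd p) < t)
               (fun p => D p /\ t < h (fst p) (snd p))) as [H|H].
  - intros [u v] [Duv Hlt]. simpl in Hlt.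
    apply filter_and; [now apply oD|].
    apply continuity_2d_pt_filterlim with (1 := ch u v Duv)
      (P := fun y => y < t). now apply (open_lt t).
  - intros [u v] [Duv Hlt]. simpl in Hlt.
    apply filter_and; [now apply oD|].
    apply continuity_2d_pt_filterlim with (1 := ch u v Duv)
      (P := fun y => t < y). now apply (open_gt t).
  - intros [u v] Duv. simpl.
    destruct (Rtotal_order (h u v) t) as [H|[H|H]].
    + now left.
    + now destruct (nt u v Duv).
    + now right.
  - intros [u v] _ [_ H1] [_ H2]. simpl in *. lra.
  - left. intros u v Duv. now destruct (H (u, v) Duv).
  - right. intros u v Duv. now destruct (H (u, v) Duv).
Qed.

Lemma is_derive_0_eq (h : R -> R) (a b : R) :
  (forall t, Rmin a b <= t <= Rmax a b -> is_derive h t 0) -> h a = h b.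
Proof.
  intros H. destruct (MVT_gen h a b (fun _ => 0)) as [c [_ Hc]].
  - intros x Hx. apply H. lra.
  - intros x Hx. apply derivable_continuous_pt. exists 0.
    apply is_derive_Reals. now apply H.
  - lra.
Qed.

(** A function with vanishing partial derivatives on a domain is constant:
    it is locally constant, so the set where it takes a given value and the
    complement of that set are both open. *)
Lemma zero_partials_const (D : R * R -> Prop) (h : R -> R -> R) :
  is_domain D ->
  (forall u v, D (u, v) -> is_derive (fun t => h t v) u 0) ->
  (forall u v, D (u, v) -> is_derive (fun t => h u t) v 0) ->
  exists c, forall u v, D (u, v) -> h u v = c.
Proof.
  intros [oD [cD [[u0 v0] D0]]] hu hv.
  assert (loc : forall u v, D (u, v) ->
            locally (u, v) (fun p => D p /\ h (fst p) (snd p) = h u v)).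
  { intros u v Duv.
    destruct (open_locally_2d D u v oD Duv) as [d Hd].
    apply filter_imp with (fun p => D (fst p, snd p) /\ h (fst p) (snd p) = h u v).
    { now intros [x y] H. }
    apply (locally_2d_locally (fun x y => D (x, y) /\ h x y = h u v)).
    exists d. intros x y Hx Hy. split; [now apply Hd|].
    assert (seg : forall a b t, Rabs (a - b) < d ->
              Rmin a b <= t <= Rmax a b -> Rabs (t - b) < d).
    { intros a b t. unfold Rmin, Rmax.
      destruct (Rle_dec a b); unfold Rabs;
        destruct (Rcase_abs (a - b)); destruct (Rcase_abs (t - b)); lra. }
    transitivity (h u y).
    - apply (is_derive_0_eq (fun t => h t y)). intros t Ht. apply hu.
      apply Hd; [now apply (seg x u)|assumption].
    - apply (is_derive_0_eq (fun t => h u t)). intros t Ht. apply hv.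
      apply Hd; [|now apply (seg y v)].
      replace (u - u) with 0 by ring. rewrite Rabs_R0. apply cond_pos. }
  exists (h u0 v0).
  destruct (cD (fun p => D p /\ h (fst p) (snd p) = h u0 v0)
               (fun p => D p /\ h (fst p) (snd p) <> h u0 v0)) as [H|H].
  - intros [u v] [Duv E]. simpl in E. rewrite <- E. now apply loc.
  - intros [u v] [Duv E]. simpl in E.
    apply filter_imp with (2 := loc u v Duv). intros [x y] [Dp Ep]. simpl in *.
    split; congruence.
  - intros [u v] Duv. simpl.
    destruct (Req_dec (h u v) (h u0 v0)); [left|right]; now split.
  - intros p _ [_ H1] [_ H2]. now apply H2.
  - intros u v Duv. now destruct (H (u, v) Duv).
  - destruct (H (u0, v0) D0) as [_ H0]. now destruct H0.
Qed.

Lemma smooth2_continuity (D : R * R -> Prop) (h : R -> R -> R) (u v : R) :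
  smooth2 D h -> D (u, v) -> continuity_2d_pt h u v.
Proof. intros sh Duv. exact (proj1 (sh u v Duv 0%nat)). Qed.

Lemma smooth2_ex_derive_u (D : R * R -> Prop) (h : R -> R -> R) (u v : R) :
  smooth2 D h -> D (u, v) -> ex_derive (fun t => h t v) u.
Proof. intros sh Duv. now destruct (sh u v Duv 1%nat) as [_ [H _]]. Qed.

Lemma smooth2_ex_derive_v (D : R * R -> Prop) (h : R -> R -> R) (u v : R) :
  smooth2 D h -> D (u, v) -> ex_derive (fun t => h u t) v.
Proof. intros sh Duv. now destruct (sh u v Duv 1%nat) as [_ [_ [H _]]]. Qed.

Lemma smooth2_Derive_u (D : R * R -> Prop) (h : R -> R -> R) :
  smooth2 D h -> smooth2 D (fun u v => Derive (fun t => h t v) u).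
Proof.
  intros sh u v Duv n. now destruct (sh u v Duv (S n)) as [_ [_ [_ [H _]]]].
Qed.

Lemma smooth2_Derive_v (D : R * R -> Prop) (h : R -> R -> R) :
  smooth2 D h -> smooth2 D (fun u v => Derive (fun t => h u t) v).
Proof.
  intros sh u v Duv n. now destruct (sh u v Duv (S n)) as [_ [_ [_ [_ H]]]].
Qed.

Lemma smooth2_subset (D D' : R * R -> Prop) (h : R -> R -> R) :
  (forall u v, D' (u, v) -> D (u, v)) -> smooth2 D h -> smooth2 D' h.
Proof. intros sub sh u v H. exact (sh u v (sub u v H)). Qed.

Lemma smooth2_ext (D : R * R -> Prop) (h k : R -> R -> R) :
  open D -> (forall u v, D (u, v) -> h u v = k u v) ->
  smooth2 D h -> smooth2 D k.
Proof.
  intros oD E sh u v Duv n.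
  apply ex_diff_n_ext_loc with (2 := sh u v Duv n).
  apply locally_2d_impl with (2 := open_locally_2d D u v oD Duv).
  apply locally_2d_forall. intros x y. apply E.
Qed.

Lemma smooth2_plus_scal (D : R * R -> Prop) (h k : R -> R -> R) (a : R) :
  open D -> smooth2 D h -> smooth2 D k ->
  smooth2 D (fun u v => h u v + a * k u v).
Proof.
  intros oD sh sk u v Duv n. revert h k sh sk u v Duv.
  assert (cont : forall h k u v, continuity_2d_pt h u v ->
     continuity_2d_pt k u v ->
     continuity_2d_pt (fun x y => h x y + a * k x y) u v).
  { intros h k u v ch ck. apply continuity_2d_pt_plus; [assumption|].
    apply continuity_2d_pt_mult; [apply continuity_2d_pt_const|assumption]. }
  induction n as [|n IH]; intros h k sh sk u v Duv.
  - split; [|exact I].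
    apply cont; now apply smooth2_continuity with D.
  - repeat split.
    + apply cont; now apply smooth2_continuity with D.
    + apply @ex_derive_plus; [now apply smooth2_ex_derive_u with D|].
      apply @ex_derive_scal. now apply smooth2_ex_derive_u with D.
    + apply @ex_derive_plus; [now apply smooth2_ex_derive_v with D|].
      apply @ex_derive_scal. now apply smooth2_ex_derive_v with D.
    + apply ex_diff_n_ext_loc with
        (fun x y => Derive (fun t => h t y) x + a * Derive (fun t => k t y) x).
      * apply locally_2d_impl with (2 := open_locally_2d D u v oD Duv).
        apply locally_2d_forall. intros x y Dxy.
        rewrite Derive_plus, Derive_scal; trivial.
        -- now apply smooth2_ex_derive_u with D.
        -- apply @ex_derive_scal. now apply smooth2_ex_derive_u with D.
      * apply IH; trivial; now apply smooth2_Derive_u.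
    + apply ex_diff_n_ext_loc with
        (fun x y => Derive (fun t => h x t) y + a * Derive (fun t => k x t) y).
      * apply locally_2d_impl with (2 := open_locally_2d D u v oD Duv).
        apply locally_2d_forall. intros x y Dxy.
        rewrite Derive_plus, Derive_scal; trivial.
        -- now apply smooth2_ex_derive_v with D.
        -- apply @ex_derive_scal. now apply smooth2_ex_derive_v with D.
      * apply IH; trivial; now apply smooth2_Derive_v.
Qed.

Lemma smooth2_Schwarz (D : R * R -> Prop) (h : R -> R -> R) (u v : R) :
  open D -> smooth2 D h -> D (u, v) ->
  Derive (fun x => Derive (fun y => h x y) v) u =
  Derive (fun y => Derive (fun x => h x y) u) v.
Proof.
  intros oD sh Duv. apply (Schwarz h).
  - apply locally_2d_impl with (2 := open_locally_2d D u v oD Duv).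
    apply locally_2d_forall. intros x y Dxy. repeat split.
    + now apply smooth2_ex_derive_u with D.
    + now apply smooth2_ex_derive_v with D.
    + apply (smooth2_ex_derive_u D (fun u v => Derive (fun t => h u t) v));
        [now apply smooth2_Derive_v|assumption].
    + apply (smooth2_ex_derive_v D (fun u v => Derive (fun t => h t v) u));
        [now apply smooth2_Derive_u|assumption].
  - apply (smooth2_continuity D); [|assumption].
    apply (smooth2_Derive_u D (fun u v => Derive (fun t => h u t) v)).
    now apply smooth2_Derive_v.
  - apply (smooth2_continuity D); [|assumption].
    apply (smooth2_Derive_v D (fun u v => Derive (fun t => h t v) u)).
    now apply smooth2_Derive_u.
Qed.

(** * Smooth functions of one variable *)

(** All derivatives exist at every point of [U], which is meant to be open. *)
Definition smooth_on (U : R -> Prop) (h : R -> R) : Prop :=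
  forall n x, U x -> ex_derive_n h n x.

(** The hypothesis is needed because [ex_derive_n h 1] says that [h] is
    derivable, whereas [ex_derive_n (Derive h) 0] says nothing. *)
Lemma ex_derive_n_S (h : R -> R) (n : nat) (x : R) :
  ex_derive h x -> ex_derive_n h (S n) x <-> ex_derive_n (Derive h) n x.
Proof.
  intros H0. destruct n as [|n]; simpl; [tauto|].
  assert (E : forall t, Derive (Derive_n h n) t = Derive_n (Derive h) n t).
  { intros t. change (Derive_n h (S n) t = Derive_n (Derive h) n t).
    rewrite <- (Nat.add_1_r n). symmetry. exact (Derive_n_comp h n 1 t). }
  split; apply ex_derive_ext; intros t; now rewrite E.
Qed.

Lemma ex_derive_n_ext_open (U : R -> Prop) (h k : R -> R) (n : nat) (x : R) :
  open U -> U x -> (forall t, U t -> h t = k t) ->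
  ex_derive_n h n x -> ex_derive_n k n x.
Proof.
  intros oU Ux E. apply ex_derive_n_ext_loc.
  apply filter_imp with (2 := oU x Ux). exact E.
Qed.

Lemma ex_derive_n_mult_open (U : R -> Prop) (n : nat) (h k : R -> R) :
  open U ->
  (forall m x, (m <= n)%nat -> U x -> ex_derive_n h m x) ->
  (forall m x, (m <= n)%nat -> U x -> ex_derive_n k m x) ->
  forall m x, (m <= n)%nat -> U x -> ex_derive_n (fun t => h t * k t) m x.
Proof.
  intros oU. revert h k. induction n as [|n IH]; intros h k sh sk m x Hm Ux.
  - replace m with 0%nat by lia. exact I.
  - destruct m as [|m]; [exact I|].
    assert (dh : forall t, U t -> ex_derive h t)
      by (intros t Ut; apply (sh 1%nat t); [lia|assumption]).
    assert (dk : forall t, U t -> ex_derive k t)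
      by (intros t Ut; apply (sk 1%nat t); [lia|assumption]).
    apply ex_derive_n_S; [apply @ex_derive_mult; auto|].
    apply ex_derive_n_ext_open with U (fun t => Derive h t * k t + h t * Derive k t);
      trivial.
    { intros t Ut. symmetry. apply Derive_mult; auto. }
    apply ex_derive_n_plus.
    + apply filter_imp with (2 := oU x Ux). intros t Ut j Hj.
      apply IH; trivial; [| |lia].
      * intros i y Hi Uy. apply ex_derive_n_S; auto. apply sh; trivial; lia.
      * intros i y Hi Uy. apply sk; trivial; lia.
    + apply filter_imp with (2 := oU x Ux). intros t Ut j Hj.
      apply IH; trivial; [| |lia].
      * intros i y Hi Uy. apply sh; trivial; lia.
      * intros i y Hi Uy. apply ex_derive_n_S; auto. apply sk; trivial; lia.
Qed.

(** By induction on the order, from [(1 / h)' = - h' (1 / h) ^ 2]. *)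
Lemma smooth_on_inv (U : R -> Prop) (h : R -> R) :
  open U -> (forall x, U x -> h x <> 0) -> smooth_on U h ->
  smooth_on U (fun t => / h t).
Proof.
  intros oU nz sh.
  assert (dh : forall t, U t -> ex_derive h t)
    by (intros t Ut; apply (sh 1%nat t Ut)).
  enough (H : forall n m x, (m <= n)%nat -> U x ->
            ex_derive_n (fun t => / h t) m x)
    by (intros n x Ux; now apply (H n n)).
  induction n as [|n IH]; intros m x Hm Ux.
  - replace m with 0%nat by lia. exact I.
  - destruct m as [|m]; [exact I|].
    apply ex_derive_n_S; [apply ex_derive_inv; auto|].
    apply ex_derive_n_ext_open with U
      (fun t => - (Derive h t * (/ h t * / h t))); trivial.
    { intros t Ut. rewrite Derive_inv; auto. field. auto. }
    apply ex_derive_n_opp.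
    apply (ex_derive_n_mult_open U n); trivial; [| |lia].
    + intros i y Hi Uy. apply ex_derive_n_S; auto.
    + now apply (ex_derive_n_mult_open U n).
Qed.

Lemma smooth1_ex_derive (I : R -> Prop) (h : R -> R) (x : R) :
  smooth1 I h -> I x -> ex_derive h x.
Proof. intros sh Ix. exact (locally_singleton _ _ (sh x Ix) 1%nat). Qed.

(** The functions [e f / (1 - a f)] that describe the principal curvatures of
    a parallel surface. *)
Definition parallel_curvature (e a : R) (f : R -> R) (x : R) : R :=
  e * f x / (1 - a * f x).

Lemma smooth1_parallel_curvature (I : R -> Prop) (f : R -> R) (e a : R) :
  a <> 0 -> smooth1 I f -> (forall x, I x -> 1 - a * f x <> 0) ->
  smooth1 I (parallel_curvature e a f).
Proof.
  intros ha sf nz x Ix.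
  assert (H : locally x (fun y => (forall n, ex_derive_n f n y) /\ 1 - a * f y <> 0)).
  { apply filter_and; [now apply sf|].
    assert (c : continuous (fun y => 1 - a * f y) x).
    { apply @ex_derive_continuous. apply @ex_derive_minus.
      - apply ex_derive_const.
      - apply @ex_derive_scal. now apply smooth1_ex_derive with I. }
    apply (c (fun y => y <> 0)). apply (open_neq 0). now apply nz. }
  set (U := fun y => locally y
              (fun t => (forall n, ex_derive_n f n t) /\ 1 - a * f t <> 0)).
  assert (oU : open U) by (intros y Uy; now apply locally_locally).
  assert (nzU : forall y, U y -> 1 - a * f y <> 0)
    by (intros y Uy; now destruct (locally_singleton _ _ Uy)).
  assert (sU : smooth_on U f)
    by (intros n y Uy; now destruct (locally_singleton _ _ Uy)).
  assert (sV : smooth_on U (fun t => / (1 - a * f t))).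
  { apply smooth_on_inv; trivial. intros n y Uy.
    apply ex_derive_n_minus.
    - apply filter_forall. intros t k _. apply ex_derive_n_const.
    - apply filter_imp with (2 := oU y Uy). intros t Ut k _.
      apply ex_derive_n_scal_l. now apply sU. }
  apply filter_imp with (2 := oU x H). intros y Uy n.
  (* [e f / (1 - a f) = (e / a) / (1 - a f) - e / a], so that only the inverse
     of a smooth function is needed. *)
  apply ex_derive_n_ext_open with U (fun t => e / a * / (1 - a * f t) - e / a);
    trivial.
  { intros t Ut. unfold parallel_curvature. field. auto. }
  apply ex_derive_n_minus.
  - apply filter_imp with (2 := oU y Uy). intros t Ut k _.
    apply ex_derive_n_scal_l. now apply sV.
  - apply filter_forall. intros t k _. apply ex_derive_n_const.
Qed.

(** * Curves in Minkowski space *)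

(** Componentwise derivability of a curve. *)
Definition ex_derive31 (w : R -> R31) (t : R) : Prop :=
  ex_derive (fun s => c1 (w s)) t /\
  ex_derive (fun s => c2 (w s)) t /\
  ex_derive (fun s => c3 (w s)) t.

(** Componentwise derivative of a curve; [Du] and [Dv] are its instances on
    the coordinate lines. *)
Definition Derive31 (w : R -> R31) (t : R) : R31 :=
  (Derive (fun s => c1 (w s)) t,
   Derive (fun s => c2 (w s)) t,
   Derive (fun s => c3 (w s)) t).

Lemma R31_eq (x y : R31) : c1 x = c1 y -> c2 x = c2 y -> c3 x = c3 y -> x = y.
Proof.
  destruct x as [[x1 x2] x3], y as [[y1 y2] y3]. unfold c1, c2, c3. simpl.
  now intros -> -> ->.
Qed.

Lemma mdot_sym (x y : R31) : mdot x y = mdot y x.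
Proof. unfold mdot. ring. Qed.

Lemma mdot_scal_l (k : R) (x y : R31) : mdot (scal31 k x) y = k * mdot x y.
Proof. unfold mdot, scal31, c1, c2, c3. simpl. ring. Qed.

Lemma mdot_scal_r (k : R) (x y : R31) : mdot x (scal31 k y) = k * mdot x y.
Proof. now rewrite mdot_sym, mdot_scal_l, mdot_sym. Qed.

Lemma mdot_add_l (x y z : R31) : mdot (add31 x y) z = mdot x z + mdot y z.
Proof. unfold mdot, add31, c1, c2, c3. simpl. ring. Qed.

(** Derivative of a constant inner product of two curves. *)
Lemma mdot_const_Derive31 (X Y : R -> R31) (k t : R) :
  ex_derive31 X t -> ex_derive31 Y t ->
  locally t (fun s => mdot (X s) (Y s) = k) ->
  mdot (Derive31 X t) (Y t) + mdot (X t) (Derive31 Y t) = 0.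
Proof.
  intros [X1 [X2 X3]] [Y1 [Y2 Y3]] H.
  transitivity (Derive (fun s => mdot (X s) (Y s)) t);
    [|exact (eq_trans (Derive_ext_loc _ _ _ H) (Derive_const k t))].
  symmetry. apply is_derive_unique.
  assert (H' : forall x1 x2 x3 y1 y2 y3 : R -> R,
    ex_derive x1 t -> ex_derive x2 t -> ex_derive x3 t ->
    ex_derive y1 t -> ex_derive y2 t -> ex_derive y3 t ->
    is_derive (fun s => x1 s * y1 s + x2 s * y2 s - x3 s * y3 s) t
      (Derive (fun s => x1 s) t * y1 t +
       Derive (fun s => x2 s) t * y2 t - Derive (fun s => x3 s) t * y3 t +
       (x1 t * Derive (fun s => y1 s) t +
        x2 t * Derive (fun s => y2 s) t - x3 t * Derive (fun s => y3 s) t))).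
  { intros. auto_derive; [repeat split; assumption|ring]. }
  exact (H' _ _ _ _ _ _ X1 X2 X3 Y1 Y2 Y3).
Qed.

(** A vector orthogonal to two orthogonal space-like vectors and to a time-like
    unit vector orthogonal to them vanishes: with [d] the determinant of the
    three vectors, [d ^ 2] is minus their Gram determinant, and Cramer's rule
    gives [d * w = 0]. *)
Lemma orthogonal_frame_0 (p q n w : R31) :
  0 < mdot p p -> 0 < mdot q q -> mdot n n = -1 ->
  mdot p q = 0 -> mdot n p = 0 -> mdot n q = 0 ->
  mdot w p = 0 -> mdot w q = 0 -> mdot w n = 0 ->
  w = (0, 0, 0).
Proof.
  destruct p as [[p1 p2] p3], q as [[q1 q2] q3], n as [[n1 n2] n3],
    w as [[w1 w2] w3].
  intros Hp Hq Hn Hpq Hnp Hnq Hwp Hwq Hwn.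
  set (d := p1 * (q2 * n3 - q3 * n2) - p2 * (q1 * n3 - q3 * n1)
            + p3 * (q1 * n2 - q2 * n1)).
  assert (Hd : d <> 0).
  { assert (G : d * d = - (mdot (p1, p2, p3) (p1, p2, p3) *
        (mdot (q1, q2, q3) (q1, q2, q3) * mdot (n1, n2, n3) (n1, n2, n3)
         - mdot (n1, n2, n3) (q1, q2, q3) * mdot (n1, n2, n3) (q1, q2, q3))
      - mdot (p1, p2, p3) (q1, q2, q3) *
        (mdot (p1, p2, p3) (q1, q2, q3) * mdot (n1, n2, n3) (n1, n2, n3)
         - mdot (n1, n2, n3) (q1, q2, q3) * mdot (n1, n2, n3) (p1, p2, p3))
      + mdot (n1, n2, n3) (p1, p2, p3) *
        (mdot (p1, p2, p3) (q1, q2, q3) * mdot (n1, n2, n3) (q1, q2, q3)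
         - mdot (n1, n2, n3) (p1, p2, p3) * mdot (q1, q2, q3) (q1, q2, q3)))).
    { unfold d, mdot, c1, c2, c3. simpl. ring. }
    rewrite Hn, Hpq, Hnp, Hnq in G.
    assert (0 < mdot (p1, p2, p3) (p1, p2, p3) * mdot (q1, q2, q3) (q1, q2, q3))
      by now apply Rmult_lt_0_compat.
    intros E. rewrite E in G. lra. }
  unfold mdot, c1, c2, c3 in Hwp, Hwq, Hwn. simpl in Hwp, Hwq, Hwn.
  apply R31_eq; unfold c1, c2, c3; simpl; apply Rmult_eq_reg_l with (2 := Hd);
    rewrite Rmult_0_r.
  - transitivity ((q2 * n3 - q3 * n2) * (w1 * p1 + w2 * p2 - w3 * p3)
      - (p2 * n3 - p3 * n2) * (w1 * q1 + w2 * q2 - w3 * q3)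
      + (p2 * q3 - p3 * q2) * (w1 * n1 + w2 * n2 - w3 * n3));
      [unfold d; ring|rewrite Hwp, Hwq, Hwn; ring].
  - transitivity (- (q1 * n3 - q3 * n1) * (w1 * p1 + w2 * p2 - w3 * p3)
      + (p1 * n3 - p3 * n1) * (w1 * q1 + w2 * q2 - w3 * q3)
      - (p1 * q3 - p3 * q1) * (w1 * n1 + w2 * n2 - w3 * n3));
      [unfold d; ring|rewrite Hwp, Hwq, Hwn; ring].
  - transitivity (- (q1 * n2 - q2 * n1) * (w1 * p1 + w2 * p2 - w3 * p3)
      + (p1 * n2 - p2 * n1) * (w1 * q1 + w2 * q2 - w3 * q3)
      - (p1 * q2 - p2 * q1) * (w1 * n1 + w2 * n2 - w3 * n3));
      [unfold d; ring|rewrite Hwp, Hwq, Hwn; ring].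
Qed.

(** * Surfaces in principal parameters *)

Lemma smooth_map_ex_derive_u (D : R * R -> Prop) (w : R -> R -> R31) (u v : R) :
  smooth_map D w -> D (u, v) -> ex_derive31 (fun t => w t v) u.
Proof.
  intros [w1 [w2 w3]] Duv. repeat split.
  - exact (smooth2_ex_derive_u D _ u v w1 Duv).
  - exact (smooth2_ex_derive_u D _ u v w2 Duv).
  - exact (smooth2_ex_derive_u D _ u v w3 Duv).
Qed.

Lemma smooth_map_ex_derive_v (D : R * R -> Prop) (w : R -> R -> R31) (u v : R) :
  smooth_map D w -> D (u, v) -> ex_derive31 (fun t => w u t) v.
Proof.
  intros [w1 [w2 w3]] Duv. repeat split.
  - exact (smooth2_ex_derive_v D _ u v w1 Duv).
  - exact (smooth2_ex_derive_v D _ u v w2 Duv).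
  - exact (smooth2_ex_derive_v D _ u v w3 Duv).
Qed.

Lemma smooth_map_Du (D : R * R -> Prop) (w : R -> R -> R31) :
  smooth_map D w -> smooth_map D (Du w).
Proof.
  intros [w1 [w2 w3]]. repeat split; now apply smooth2_Derive_u.
Qed.

Lemma smooth_map_Dv (D : R * R -> Prop) (w : R -> R -> R31) :
  smooth_map D w -> smooth_map D (Dv w).
Proof.
  intros [w1 [w2 w3]]. repeat split; now apply smooth2_Derive_v.
Qed.

Lemma smooth_map_subset (D D' : R * R -> Prop) (w : R -> R -> R31) :
  (forall u v, D' (u, v) -> D (u, v)) -> smooth_map D w -> smooth_map D' w.
Proof.
  intros sub [w1 [w2 w3]]. repeat split; now apply smooth2_subset with D.
Qed.

Lemma Du_Dv_comm (D : R * R -> Prop) (w : R -> R -> R31) (u v : R) :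
  open D -> smooth_map D w -> D (u, v) -> Du (Dv w) u v = Dv (Du w) u v.
Proof.
  intros oD [w1 [w2 w3]] Duv. apply R31_eq.
  - exact (smooth2_Schwarz D _ u v oD w1 Duv).
  - exact (smooth2_Schwarz D _ u v oD w2 Duv).
  - exact (smooth2_Schwarz D _ u v oD w3 Duv).
Qed.

Lemma mdot_const_Du (D : R * R -> Prop) (X Y : R -> R -> R31) (k u v : R) :
  open D -> smooth_map D X -> smooth_map D Y ->
  (forall u v, D (u, v) -> mdot (X u v) (Y u v) = k) -> D (u, v) ->
  mdot (Du X u v) (Y u v) + mdot (X u v) (Du Y u v) = 0.
Proof.
  intros oD sX sY H Duv.
  apply (mdot_const_Derive31 (fun t => X t v) (fun t => Y t v) k u).
  - now apply smooth_map_ex_derive_u with D.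
  - now apply smooth_map_ex_derive_u with D.
  - apply filter_imp with (2 := open_locally_u D u v oD Duv). auto.
Qed.

Lemma mdot_const_Dv (D : R * R -> Prop) (X Y : R -> R -> R31) (k u v : R) :
  open D -> smooth_map D X -> smooth_map D Y ->
  (forall u v, D (u, v) -> mdot (X u v) (Y u v) = k) -> D (u, v) ->
  mdot (Dv X u v) (Y u v) + mdot (X u v) (Dv Y u v) = 0.
Proof.
  intros oD sX sY H Duv.
  apply (mdot_const_Derive31 (fun t => X u t) (fun t => Y u t) k v).
  - now apply smooth_map_ex_derive_v with D.
  - now apply smooth_map_ex_derive_v with D.
  - apply filter_imp with (2 := open_locally_v D u v oD Duv). auto.
Qed.

Lemma spacelike_at_pos (z : R -> R -> R31) (u v : R) :
  spacelike_at z u v -> 0 < coefE z u v /\ 0 < coefG z u v.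
Proof.
  intros H. split.
  - assert (P : (1, 0) <> (0, 0)) by (intros E; injection E; lra).
    generalize (H 1 0 P). lra.
  - assert (P : (0, 1) <> (0, 0)) by (intros E; injection E; lra).
    generalize (H 0 1 P). lra.
Qed.

Lemma scal31_of_add_0 (k : R) (x y : R31) :
  add31 x (scal31 k y) = (0, 0, 0) -> x = scal31 (- k) y.
Proof.
  destruct x as [[x1 x2] x3], y as [[y1 y2] y3].
  unfold add31, scal31, c1, c2, c3. simpl.
  intros E. injection E. intros E3 E2 E1. repeat f_equal; lra.
Qed.

(** Rodrigues' formulas: in principal parameters the derivatives of the normal
    are [l_u = - nu1 z_u] and [l_v = - nu2 z_v]. *)
Lemma Rodrigues_u (D : R * R -> Prop) (z l : R -> R -> R31) (u v : R) :
  open D -> spacelike_surface z l D -> principal_parameters z l D -> D (u, v) ->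
  Du l u v = scal31 (- nu1 z l u v) (Du z u v).
Proof.
  intros oD [sz [sl hS]] hP Duv.
  destruct (hS u v Duv) as [hsp [[lu [lv ll]] _]].
  destruct (hP u v Duv) as [F0 M0].
  destruct (spacelike_at_pos z u v hsp) as [Epos Gpos].
  unfold coefE, coefF, coefG in *.
  assert (Hl : mdot (Du l u v) (l u v) = 0).
  { assert (H := mdot_const_Du D l l (-1) u v oD sl sl
      (fun u v H => proj2 (proj2 (proj1 (proj2 (hS u v H))))) Duv).
    rewrite (mdot_sym (l u v)) in H. lra. }
  assert (Hu : mdot (Du l u v) (Du z u v) = - coefL z l u v).
  { assert (H := mdot_const_Du D l (Du z) 0 u v oD sl (smooth_map_Du D z sz)
      (fun u v H => proj1 (proj1 (proj2 (hS u v H)))) Duv).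
    unfold coefL. lra. }
  assert (Hv : mdot (Du l u v) (Dv z u v) = 0).
  { assert (H := mdot_const_Du D l (Dv z) 0 u v oD sl (smooth_map_Dv D z sz)
      (fun u v H => proj1 (proj2 (proj1 (proj2 (hS u v H))))) Duv).
    rewrite (Du_Dv_comm D) in H by assumption. unfold coefM in M0. lra. }
  apply scal31_of_add_0.
  apply (orthogonal_frame_0 (Du z u v) (Dv z u v) (l u v));
    trivial; rewrite mdot_add_l, mdot_scal_l.
  - rewrite Hu. unfold nu1, coefE. field. lra.
  - rewrite Hv, F0. ring.
  - rewrite Hl, mdot_sym, lu. ring.
Qed.

Lemma Rodrigues_v (D : R * R -> Prop) (z l : R -> R -> R31) (u v : R) :
  open D -> spacelike_surface z l D -> principal_parameters z l D -> D (u, v) ->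
  Dv l u v = scal31 (- nu2 z l u v) (Dv z u v).
Proof.
  intros oD [sz [sl hS]] hP Duv.
  destruct (hS u v Duv) as [hsp [[lu [lv ll]] _]].
  destruct (hP u v Duv) as [F0 M0].
  destruct (spacelike_at_pos z u v hsp) as [Epos Gpos].
  unfold coefE, coefF, coefG in *.
  assert (Hl : mdot (Dv l u v) (l u v) = 0).
  { assert (H := mdot_const_Dv D l l (-1) u v oD sl sl
      (fun u v H => proj2 (proj2 (proj1 (proj2 (hS u v H))))) Duv).
    rewrite (mdot_sym (l u v)) in H. lra. }
  assert (Hv : mdot (Dv l u v) (Dv z u v) = - coefN z l u v).
  { assert (H := mdot_const_Dv D l (Dv z) 0 u v oD sl (smooth_map_Dv D z sz)
      (fun u v H => proj1 (proj2 (proj1 (proj2 (hS u v H))))) Duv).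
    unfold coefN. lra. }
  assert (Hu : mdot (Dv l u v) (Du z u v) = 0).
  { assert (H := mdot_const_Dv D l (Du z) 0 u v oD sl (smooth_map_Du D z sz)
      (fun u v H => proj1 (proj1 (proj2 (hS u v H)))) Duv).
    unfold coefM in M0. lra. }
  apply scal31_of_add_0.
  apply (orthogonal_frame_0 (Du z u v) (Dv z u v) (l u v));
    trivial; rewrite mdot_add_l, mdot_scal_l.
  - rewrite Hu, (mdot_sym (Dv z u v)), F0. ring.
  - rewrite Hv. unfold nu2, coefG. field. lra.
  - rewrite Hl, (mdot_sym (Dv z u v)), lv. ring.
Qed.

(** * Parallel surfaces *)

Lemma smooth_map_parallel_surface (D : R * R -> Prop) (z l : R -> R -> R31)
    (a : R) :
  open D -> smooth_map D z -> smooth_map D l ->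
  smooth_map D (parallel_surface z l a).
Proof.
  intros oD [z1 [z2 z3]] [l1 [l2 l3]].
  repeat split; now apply smooth2_plus_scal.
Qed.

Lemma Derive_plus_scal (h k : R -> R) (a t : R) :
  ex_derive h t -> ex_derive k t ->
  Derive (fun s => h s + a * k s) t = Derive h t + a * Derive k t.
Proof.
  intros dh dk.
  now rewrite Derive_plus, Derive_scal by (trivial; now apply ex_derive_scal).
Qed.

Lemma Derive31_parallel (z l : R -> R31) (a t : R) :
  ex_derive31 z t -> ex_derive31 l t ->
  Derive31 (fun s => add31 (z s) (scal31 a (l s))) t =
  add31 (Derive31 z t) (scal31 a (Derive31 l t)).
Proof.
  intros [z1 [z2 z3]] [l1 [l2 l3]].
  apply R31_eq.
  - exact (Derive_plus_scal _ _ a t z1 l1).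
  - exact (Derive_plus_scal _ _ a t z2 l2).
  - exact (Derive_plus_scal _ _ a t z3 l3).
Qed.

Lemma add31_scal31_scal31 (a k : R) (x : R31) :
  add31 x (scal31 a (scal31 (- k) x)) = scal31 (1 - a * k) x.
Proof.
  apply R31_eq; unfold add31, scal31, c1, c2, c3; simpl; ring.
Qed.

Lemma Du_parallel_surface (D : R * R -> Prop) (z l : R -> R -> R31) (a u v : R) :
  open D -> spacelike_surface z l D -> principal_parameters z l D -> D (u, v) ->
  Du (parallel_surface z l a) u v = scal31 (1 - a * nu1 z l u v) (Du z u v).
Proof.
  intros oD hS hP Duv.
  rewrite <- add31_scal31_scal31, <- (Rodrigues_u D z l u v oD hS hP Duv).
  destruct hS as [sz [sl _]].
  apply (Derive31_parallel (fun t => z t v) (fun t => l t v));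
    now apply smooth_map_ex_derive_u with D.
Qed.

Lemma Dv_parallel_surface (D : R * R -> Prop) (z l : R -> R -> R31) (a u v : R) :
  open D -> spacelike_surface z l D -> principal_parameters z l D -> D (u, v) ->
  Dv (parallel_surface z l a) u v = scal31 (1 - a * nu2 z l u v) (Dv z u v).
Proof.
  intros oD hS hP Duv.
  rewrite <- add31_scal31_scal31, <- (Rodrigues_v D z l u v oD hS hP Duv).
  destruct hS as [sz [sl _]].
  apply (Derive31_parallel (fun t => z u t) (fun t => l u t));
    now apply smooth_map_ex_derive_v with D.
Qed.

Lemma parallel_first_form (D : R * R -> Prop) (z l : R -> R -> R31) (a u v : R) :
  open D -> spacelike_surface z l D -> principal_parameters z l D -> D (u, v) ->
  coefE (parallel_surface z l a) u v = (1 - a * nu1 z l u v) ^ 2 * coefE z u v /\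
  coefF (parallel_surface z l a) u v = 0 /\
  coefG (parallel_surface z l a) u v = (1 - a * nu2 z l u v) ^ 2 * coefG z u v.
Proof.
  intros oD hS hP Duv. unfold coefE, coefF, coefG.
  rewrite (Du_parallel_surface D), (Dv_parallel_surface D) by assumption.
  rewrite !mdot_scal_l, !mdot_scal_r.
  repeat split; try ring.
  destruct (hP u v Duv) as [F0 _]. unfold coefF in F0. rewrite F0. ring.
Qed.

(** The coefficients are taken with respect to the normal [e l], where only the
    value of the sign [e] at the point matters. *)
Lemma parallel_second_form (D : R * R -> Prop) (z l : R -> R -> R31) (a u v : R) :
  open D -> spacelike_surface z l D -> principal_parameters z l D -> D (u, v) ->
  let e := sign (parallel_factor z l a u v) in
  coefL (parallel_surface z l a) (parallel_normal z l a) u v =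
    e * (nu1 z l u v * (1 - a * nu1 z l u v) * coefE z u v) /\
  coefM (parallel_surface z l a) (parallel_normal z l a) u v = 0 /\
  coefN (parallel_surface z l a) (parallel_normal z l a) u v =
    e * (nu2 z l u v * (1 - a * nu2 z l u v) * coefG z u v).
Proof.
  intros oD hS hP Duv e.
  assert (hS' := hS). destruct hS' as [sz [sl hS']].
  assert (sb := smooth_map_parallel_surface D z l a oD sz sl).
  (* The normal of the original surface is orthogonal to the parallel surface,
     so its second form can be read off the first derivatives. *)
  assert (lu : forall u v, D (u, v) ->
      mdot (l u v) (Du (parallel_surface z l a) u v) = 0).
  { intros x y Dxy. rewrite (Du_parallel_surface D), mdot_scal_r by assumption.
    destruct (hS' x y Dxy) as [_ [[H _] _]]. rewrite H. ring. }
  assert (lv : forall u v, D (u, v) ->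
      mdot (l u v) (Dv (parallel_surface z l a) u v) = 0).
  { intros x y Dxy. rewrite (Dv_parallel_surface D), mdot_scal_r by assumption.
    destruct (hS' x y Dxy) as [_ [[_ [H _]] _]]. rewrite H. ring. }
  assert (HL := mdot_const_Du D l _ 0 u v oD sl (smooth_map_Du D _ sb) lu Duv).
  assert (HM := mdot_const_Dv D l _ 0 u v oD sl (smooth_map_Du D _ sb) lu Duv).
  assert (HN := mdot_const_Dv D l _ 0 u v oD sl (smooth_map_Dv D _ sb) lv Duv).
  rewrite (Rodrigues_u D z l u v oD hS hP Duv),
    (Du_parallel_surface D z l a u v oD hS hP Duv), mdot_scal_l, mdot_scal_r in HL.
  rewrite (Rodrigues_v D z l u v oD hS hP Duv),
    (Du_parallel_surface D z l a u v oD hS hP Duv), mdot_scal_l, mdot_scal_r in HM.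
  rewrite (Rodrigues_v D z l u v oD hS hP Duv),
    (Dv_parallel_surface D z l a u v oD hS hP Duv), mdot_scal_l, mdot_scal_r in HN.
  destruct (hP u v Duv) as [F0 _]. unfold coefF in F0.
  rewrite (mdot_sym (Dv z u v)), F0 in HM.
  unfold coefL, coefM, coefN, coefE, coefG, parallel_normal. fold e.
  rewrite !mdot_scal_l. repeat split.
  - f_equal. lra.
  - apply Rmult_eq_0_compat_l. lra.
  - f_equal. lra.
Qed.

Lemma parallel_factor_nz (z l : R -> R -> R31) (a u v : R) :
  parallel_factor z l a u v <> 0 ->
  1 - a * nu1 z l u v <> 0 /\ 1 - a * nu2 z l u v <> 0.
Proof.
  unfold parallel_factor. intros H. split; intros E; apply H; rewrite E; ring.
Qed.

Lemma parallel_principal_curvatures (D : R * R -> Prop) (z l : R -> R -> R31)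
    (a u v : R) :
  open D -> spacelike_surface z l D -> principal_parameters z l D -> D (u, v) ->
  parallel_factor z l a u v <> 0 ->
  let e := sign (parallel_factor z l a u v) in
  nu1 (parallel_surface z l a) (parallel_normal z l a) u v =
    e * nu1 z l u v / (1 - a * nu1 z l u v) /\
  nu2 (parallel_surface z l a) (parallel_normal z l a) u v =
    e * nu2 z l u v / (1 - a * nu2 z l u v).
Proof.
  intros oD hS hP Duv hf e.
  destruct (parallel_factor_nz z l a u v hf) as [n1 n2].
  destruct (parallel_first_form D z l a u v oD hS hP Duv) as [HE [_ HG]].
  destruct (parallel_second_form D z l a u v oD hS hP Duv) as [HL [_ HN]].
  destruct hS as [_ [_ hS]]. destruct (hS u v Duv) as [hsp _].
  destruct (spacelike_at_pos z u v hsp) as [Epos Gpos].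
  unfold nu1 at 1, nu2 at 1. rewrite HE, HG, HL, HN. fold e.
  split; field; lra.
Qed.

(** * The integrals of the natural parameters *)

(** The data needed for the integral [intI f g x0] to be differentiable on
    [I]. As [intJ f g] is [intI g f], it serves both integrals. *)
Definition W_functions (I : R -> Prop) (f g : R -> R) (x0 : R) : Prop :=
  is_interval I /\ smooth1 I f /\ smooth1 I g /\
  (forall x, I x -> f x - g x <> 0) /\ I x0.

Lemma W_functions_sym (I : R -> Prop) (f g : R -> R) (x0 : R) :
  W_functions I f g x0 -> W_functions I g f x0.
Proof.
  intros [iI [sf [sg [nz I0]]]]. repeat (split; trivial); try apply iI.
  intros x Ix E. apply (nz x Ix). lra.
Qed.

Lemma is_derive_intI (I : R -> Prop) (f g : R -> R) (x0 x : R) :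
  W_functions I f g x0 -> I x ->
  is_derive (intI f g x0) x (Derive f x / (f x - g x)).
Proof.
  intros [[iI _] [sf [sg [nz I0]]]] Ix.
  set (phi := fun t => Derive f t / (f t - g t)).
  (* The integrand is continuous also slightly beyond the end points of [I]. *)
  assert (cont : forall y, I y -> locally y (fun t => continuous phi t)).
  { intros y Iy.
    assert (H : locally y (fun t => f t - g t <> 0)).
    { assert (c : continuous (fun t => f t - g t) y).
      { apply @ex_derive_continuous. apply @ex_derive_minus;
          now apply smooth1_ex_derive with I. }
      apply (c (fun t => t <> 0)). apply (open_neq 0). now apply nz. }
    generalize (filter_and _ _ (filter_and _ _ (sf y Iy) (sg y Iy)) H).
    apply filter_imp. intros t [[ft gt] nt].
    apply @ex_derive_continuous. apply ex_derive_mult.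
    - exact (ft 2%nat).
    - apply ex_derive_inv; [|assumption].
      apply @ex_derive_minus; [exact (ft 1%nat)|exact (gt 1%nat)]. }
  apply (is_derive_RInt phi (intI f g x0) x0 x).
  - destruct (cont x Ix) as [d Hd]. exists d. intros b Hb.
    apply @RInt_correct. apply @ex_RInt_Chasles with x.
    + apply @ex_RInt_continuous. intros y Hy. apply locally_singleton, cont.
      revert Hy. unfold Rmin, Rmax. destruct (Rle_dec x0 x); intros Hy.
      * now apply (iI x0 x).
      * now apply (iI x x0).
    + apply @ex_RInt_continuous. intros y Hy. apply Hd.
      change (Rabs (b - x) < d) in Hb. change (Rabs (y - x) < d).
      revert Hy Hb. unfold Rmin, Rmax.
      destruct (Rle_dec x b); unfold Rabs;
        destruct (Rcase_abs (b - x)); destruct (Rcase_abs (y - x)); lra.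
  - exact (locally_singleton _ _ (cont x Ix)).
Qed.

Lemma is_derive_parallel_curvature (e a : R) (f : R -> R) (x : R) :
  ex_derive f x -> 1 - a * f x <> 0 ->
  is_derive (parallel_curvature e a f) x (e * Derive f x / (1 - a * f x) ^ 2).
Proof.
  intros df nz. unfold parallel_curvature.
  auto_derive; [tauto|].
  change (Derive (fun x => f x) x) with (Derive f x). field. assumption.
Qed.

(** The condition says that the logarithmic derivative of
    [(1 - a A) exp (B' - B)] vanishes. *)
Lemma is_derive_weight (A B B' : R -> R) (k a t p q q' : R) :
  is_derive A t p -> is_derive B t q -> is_derive B' t q' ->
  (1 - a * A t) * (q' - q) = a * p ->
  is_derive (fun s => k * (1 - a * A s) * exp (B' s - B s)) t 0.
Proof.
  intros dA dB dB' E.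
  replace 0 with (k * (- (a * p) + (1 - a * A t) * (q' - q)) * exp (B' t - B t))
    by (rewrite E; ring).
  auto_derive.
  - repeat split; eexists; eassumption.
  - change (Derive (fun x => A x) t) with (Derive A t).
    change (Derive (fun x => B x) t) with (Derive B t).
    change (Derive (fun x => B' x) t) with (Derive B' t).
    rewrite (is_derive_unique _ _ _ dA), (is_derive_unique _ _ _ dB),
      (is_derive_unique _ _ _ dB'). unfold Rminus. ring.
Qed.

(** The heart of the matter, along a coordinate line: if [sqrt E exp intI] is
    constant for the given surface, then its analogue for the parallel surface
    has derivative zero. Writing [sqrt E] as a constant times [exp (- intI)],
    this is the identity
    [- a df / (1 - a f) + dk / (k - h) - df / (f - g) = 0] for
    [k = e f / (1 - a f)] and [h = e g / (1 - a g)], the principal curvatures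
    of the parallel surface. *)
Lemma parallel_weight_derive
    (I I' : R -> Prop) (f g f' g' w w' E E' : R -> R) (x0 x0' e a c t0 : R) :
  W_functions I f g x0 -> W_functions I' f' g' x0' -> e <> 0 ->
  ex_derive w t0 -> ex_derive w' t0 ->
  locally t0 (fun t =>
    I (w t) /\ sqrt (E t) * exp (intI f g x0 (w t)) = c /\
    E' t = (1 - a * f (w t)) ^ 2 * E t /\
    f' (w' t) = parallel_curvature e a f (w t)) ->
  I' (w' t0) -> g' (w' t0) = parallel_curvature e a g (w t0) ->
  1 - a * f (w t0) <> 0 -> 1 - a * g (w t0) <> 0 ->
  is_derive (fun t => sqrt (E' t) * exp (intI f' g' x0' (w' t))) t0 0.
Proof.
  intros hW hW' he dw dw' H Iw' Eg nf ng.
  destruct (locally_singleton _ _ H) as [Iw [_ [_ Ef]]].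
  assert (df := smooth1_ex_derive I f _ (proj1 (proj2 hW)) Iw).
  assert (df' := smooth1_ex_derive I' f' _ (proj1 (proj2 hW')) Iw').
  set (s := sign (1 - a * f (w t0))).
  set (p := Derive w t0 * Derive f (w t0)).
  set (p' := Derive w' t0 * Derive f' (w' t0)).
  assert (dfw : is_derive (fun t => f (w t)) t0 p).
  { apply (is_derive_comp f w); now apply Derive_correct. }
  assert (dfw' : is_derive (fun t => f' (w' t)) t0 p').
  { apply (is_derive_comp f' w'); now apply Derive_correct. }
  assert (Ep : p' = e * p / (1 - a * f (w t0)) ^ 2).
  { rewrite <- (is_derive_unique _ _ _ dfw'). apply is_derive_unique.
    apply is_derive_ext_loc with (fun t => parallel_curvature e a f (w t)).
    - apply filter_imp with (2 := H). intros t Ht. symmetry. apply Ht.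
    - replace (e * p / (1 - a * f (w t0)) ^ 2)
        with (Derive w t0 * (e * Derive f (w t0) / (1 - a * f (w t0)) ^ 2))
        by (unfold p; field; assumption).
      apply (is_derive_comp (parallel_curvature e a f) w).
      + now apply is_derive_parallel_curvature.
      + now apply Derive_correct. }
  assert (dI : is_derive (fun t => intI f g x0 (w t)) t0
                 (Derive w t0 * (Derive f (w t0) / (f (w t0) - g (w t0))))).
  { apply (is_derive_comp (intI f g x0) w).
    - now apply (is_derive_intI I).
    - now apply Derive_correct. }
  assert (dI' : is_derive (fun t => intI f' g' x0' (w' t)) t0
                  (Derive w' t0 * (Derive f' (w' t0) / (f' (w' t0) - g' (w' t0))))).
  { apply (is_derive_comp (intI f' g' x0') w').
    - now apply (is_derive_intI I').
    - now apply Derive_correct. }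
  (* The sign of [1 - a f] is locally constant. *)
  assert (Hs : locally t0 (fun t => Rabs (1 - a * f (w t)) = s * (1 - a * f (w t)))).
  { assert (ct : continuous (fun t => 1 - a * f (w t)) t0).
    { apply @ex_derive_continuous. apply @ex_derive_minus.
      - apply ex_derive_const.
      - apply ex_derive_scal. eexists. exact dfw. }
    unfold s. destruct (Rdichotomy _ _ nf) as [Hn|Hn].
    - assert (L : locally t0 (fun t => 1 - a * f (w t) < 0))
        by exact (ct (fun y => y < 0) (open_lt 0 _ Hn)).
      apply filter_imp with (2 := L). intros t Ht.
      rewrite sign_eq_m1, Rabs_left by assumption. ring.
    - assert (L : locally t0 (fun t => 0 < 1 - a * f (w t)))
        by exact (ct (fun y => 0 < y) (open_gt 0 _ Hn)).
      apply filter_imp with (2 := L). intros t Ht.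
      rewrite sign_eq_1, Rabs_pos_eq by lra. ring. }
  apply is_derive_ext_loc with (fun t => s * c * (1 - a * f (w t)) *
    exp (intI f' g' x0' (w' t) - intI f g x0 (w t))).
  - generalize (filter_and _ _ H Hs). apply filter_imp.
    intros t [[_ [Ec [EE _]]] Es].
    rewrite EE, sqrt_mult_alt by apply pow2_ge_0.
    rewrite <- Rsqr_pow2, sqrt_Rsqr_abs, Es, <- Ec.
    unfold Rminus at 2. rewrite exp_plus, exp_Ropp.
    match goal with |- ?x = ?y => change (@eq R x y) end.
    field. apply Rgt_not_eq, exp_pos.
  - apply (is_derive_weight _ _ _ _ _ _ _ _ _ dfw dI dI').
    assert (nz : f (w t0) - g (w t0) <> 0) by now apply hW.
    replace (Derive w' t0 * (Derive f' (w' t0) / (f' (w' t0) - g' (w' t0))))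
      with (p' / (f' (w' t0) - g' (w' t0))) by (unfold p', Rdiv; ring).
    replace (Derive w t0 * (Derive f (w t0) / (f (w t0) - g (w t0))))
      with (p / (f (w t0) - g (w t0))) by (unfold p, Rdiv; ring).
    rewrite Ep, Ef, Eg. unfold parallel_curvature. field.
    repeat split; trivial.
    replace (e * f (w t0) * (1 - a * g (w t0)) - e * g (w t0) * (1 - a * f (w t0)))
      with (e * (f (w t0) - g (w t0))) by ring.
    now apply Rmult_integral_contrapositive_currified.
Qed.

(** * Weingarten structure of a parallel surface *)

Lemma W_structure_W_functions (z l : R -> R -> R31) (D : R * R -> Prop)
    (I : R -> Prop) (f g : R -> R) (nu : R -> R -> R) (x0 : R) :
  W_structure z l D I f g nu -> I x0 -> W_functions I f g x0.
Proof.
  intros [iI [sf [sg [H _]]]] I0. repeat (split; trivial); try apply iI.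
  intros x Ix. now apply H.
Qed.

(** On a domain where [(1 - a nu1) (1 - a nu2)] does not vanish, its sign is
    constant. *)
Lemma parallel_sign_const (D D' : R * R -> Prop) (z l : R -> R -> R31)
    (I : R -> Prop) (f g : R -> R) (nu : R -> R -> R) (a : R) :
  W_structure z l D I f g nu -> is_domain D' ->
  (forall u v, D' (u, v) -> D (u, v) /\ parallel_factor z l a u v <> 0) ->
  exists e, e ^ 2 = 1 /\
    forall u v, D' (u, v) -> sign (parallel_factor z l a u v) = e.
Proof.
  intros [iI [sf [sg [nz [snu H]]]]] hD' hsub.
  set (F := fun x => (1 - a * f x) * (1 - a * g x)).
  assert (EF : forall u v, D' (u, v) -> parallel_factor z l a u v = F (nu u v)).
  { intros u v D'uv. destruct (hsub u v D'uv) as [Duv _].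
    destruct (H u v Duv) as [_ [E1 E2]]. unfold parallel_factor, F.
    now rewrite E1, E2. }
  destruct (domain_value_separates D' (fun u v => F (nu u v)) 0) as [S|S];
    trivial.
  - intros u v D'uv. destruct (hsub u v D'uv) as [Duv _].
    destruct (H u v Duv) as [Inu _].
    apply continuity_1d_2d_pt_comp; [|now apply smooth2_continuity with D].
    apply continuity_pt_filterlim.
    change (continuous F (nu u v)).
    apply @ex_derive_continuous.
    apply ex_derive_mult; apply @ex_derive_minus;
      try apply ex_derive_const; apply ex_derive_scal;
      now apply smooth1_ex_derive with I.
  - intros u v D'uv. rewrite <- EF by assumption. now apply hsub.
  - exists (-1). split; [ring|]. intros u v D'uv. rewrite EF by assumption.
    now apply sign_eq_m1, S.
  - exists 1. split; [ring|]. intros u v D'uv. rewrite EF by assumption.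
    now apply sign_eq_1, S.
Qed.

(** The parameter interval of a parallel surface: the points of [I] that can be
    joined to [n0] without meeting a zero of [F]. The range of [nu] itself would
    not do, since it may be a single point. *)
Definition nonzero_component (I : R -> Prop) (F : R -> R) (n0 x : R) : Prop :=
  I x /\ forall t, Rmin x n0 <= t <= Rmax x n0 -> F t <> 0.

(** The component is not a single point because [F] does not vanish near [n0];
    as [n0] may be an end point of [I], the second point is looked for on
    whichever side [I] extends. *)
Lemma nonzero_component_interval (I : R -> Prop) (F : R -> R) (n0 : R) :
  is_interval I -> I n0 -> F n0 <> 0 -> continuous F n0 ->
  is_interval (nonzero_component I F n0).
Proof.
  intros [iI [x1 [y1 [Ix1 [Iy1 lt1]]]]] I0 F0 cF. split.
  - intros x y t [Ix Hx] [Iy Hy] Ht. split; [now apply (iI x y)|].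
    intros r Hr.
    assert (Hc : Rmin x n0 <= r <= Rmax x n0 \/ Rmin y n0 <= r <= Rmax y n0).
    { revert Hr. unfold Rmin, Rmax.
      destruct (Rle_dec t n0), (Rle_dec x n0), (Rle_dec y n0); lra. }
    destruct Hc; auto.
  - assert (HF : locally n0 (fun t => F t <> 0)).
    { apply (cF (fun y => y <> 0)). now apply (open_neq 0). }
    destruct HF as [d Hd].
    assert (near : forall x, I x -> Rabs (x - n0) < d ->
              nonzero_component I F n0 x).
    { intros x Ix Hx. split; [assumption|]. intros t Ht. apply Hd.
      change (Rabs (t - n0) < d).
      revert Ht Hx. unfold Rmin, Rmax.
      destruct (Rle_dec x n0); unfold Rabs;
        destruct (Rcase_abs (x - n0)); destruct (Rcase_abs (t - n0)); lra. }
    assert (d0 := cond_pos d).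
    assert (C0 : nonzero_component I F n0 n0).
    { apply near; [assumption|]. rewrite Rminus_diag, Rabs_R0. assumption. }
    destruct (Rlt_or_le n0 y1) as [Hy|Hy].
    + assert (le1 := Rmin_l (n0 + d / 2) y1).
      assert (le2 := Rmin_r (n0 + d / 2) y1).
      assert (lt0 : n0 < Rmin (n0 + d / 2) y1) by (apply Rmin_glb_lt; lra).
      exists n0, (Rmin (n0 + d / 2) y1).
      split; [exact C0|split; [|exact lt0]].
      apply near; [apply (iI n0 y1); trivial; lra|].
      rewrite Rabs_pos_eq; lra.
    + assert (le1 := Rmax_l (n0 - d / 2) x1).
      assert (le2 := Rmax_r (n0 - d / 2) x1).
      assert (lt0 : Rmax (n0 - d / 2) x1 < n0) by (apply Rmax_lub_lt; lra).
      exists (Rmax (n0 - d / 2) x1), n0. split; [|now split].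
      apply near; [apply (iI x1 n0); trivial; lra|].
      rewrite Rabs_left; lra.
Qed.

Lemma parallel_W_surface (D D' : R * R -> Prop) (z l : R -> R -> R31)
    (I : R -> Prop) (f g : R -> R) (nu : R -> R -> R) (a : R) :
  open D -> spacelike_surface z l D -> principal_parameters z l D ->
  W_structure z l D I f g nu -> a <> 0 -> is_domain D' ->
  (forall u v, D' (u, v) -> D (u, v) /\ parallel_factor z l a u v <> 0) ->
  W_surface (parallel_surface z l a) (parallel_normal z l a) D'.
Proof.
  intros oD hS hP hW ha hD' hsub.
  destruct (parallel_sign_const D D' z l I f g nu a hW hD' hsub) as [e [e2 He]].
  assert (ne : e <> 0) by (intros E; rewrite E in e2; lra).
  destruct hW as [iI [sf [sg [nz [snu H]]]]].
  set (F := fun x => (1 - a * f x) * (1 - a * g x)).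
  assert (EF : forall u v, D' (u, v) -> F (nu u v) <> 0).
  { intros u v D'uv. destruct (hsub u v D'uv) as [Duv nF].
    destruct (H u v Duv) as [_ [E1 E2]]. unfold F. now rewrite <- E1, <- E2. }
  destruct (proj2 (proj2 hD')) as [[u0 v0] D0].
  destruct (H u0 v0 (proj1 (hsub u0 v0 D0))) as [I0 _].
  assert (cF : continuous F (nu u0 v0)).
  { apply @ex_derive_continuous.
    apply ex_derive_mult; apply @ex_derive_minus;
      try apply ex_derive_const; apply ex_derive_scal;
      now apply smooth1_ex_derive with I. }
  set (I' := nonzero_component I F (nu u0 v0)).
  assert (sub : forall x, I' x -> I x) by (intros x Ix; apply Ix).
  assert (nF : forall x, I' x -> 1 - a * f x <> 0 /\ 1 - a * g x <> 0).
  { intros x [_ Ix]. assert (N : F x <> 0) by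
      (apply Ix; split; [apply Rmin_l|apply Rmax_l]).
    unfold F in N. split; intros E; apply N; rewrite E; ring. }
  exists I', (parallel_curvature e a f), (parallel_curvature e a g), nu.
  split; [|split; [|split; [|split; [|split]]]].
  - apply nonzero_component_interval; auto.
  - apply smooth1_parallel_curvature; trivial.
    + intros x Ix. apply sf. now apply sub.
    + intros x Ix. now apply nF.
  - apply smooth1_parallel_curvature; trivial.
    + intros x Ix. apply sg. now apply sub.
    + intros x Ix. now apply nF.
  - intros x Ix. destruct (nF x Ix) as [nf ng].
    destruct (nz x (sub x Ix)) as [dfg fg].
    rewrite (is_derive_unique _ _ _ (is_derive_parallel_curvature e a f x
      (smooth1_ex_derive I f x sf (sub x Ix)) nf)).
    rewrite (is_derive_unique _ _ _ (is_derive_parallel_curvature e a g x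
      (smooth1_ex_derive I g x sg (sub x Ix)) ng)).
    split.
    + replace (e * Derive f x / (1 - a * f x) ^ 2
               * (e * Derive g x / (1 - a * g x) ^ 2))
        with (e ^ 2 * (Derive f x * Derive g x)
              * / ((1 - a * f x) * (1 - a * g x)) ^ 2) by (field; now split).
      rewrite e2, Rmult_1_l.
      apply Rmult_integral_contrapositive_currified; [assumption|].
      apply Rinv_neq_0_compat, pow_nonzero.
      now apply Rmult_integral_contrapositive_currified.
    + unfold parallel_curvature.
      replace (e * f x / (1 - a * f x) - e * g x / (1 - a * g x))
        with (e * (f x - g x) * / ((1 - a * f x) * (1 - a * g x)))
        by (field; now split).
      apply Rmult_integral_contrapositive_currified.
      * now apply Rmult_integral_contrapositive_currified.
      * apply Rinv_neq_0_compat.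
        now apply Rmult_integral_contrapositive_currified.
  - apply smooth2_subset with (2 := snu). intros u v D'uv. now apply hsub.
  - intros u v D'uv. destruct (hsub u v D'uv) as [Duv nf].
    destruct (H u v Duv) as [Inu [E1 E2]].
    destruct (parallel_principal_curvatures D z l a u v oD hS hP Duv nf)
      as [P1 P2].
    rewrite P1, P2, (He u v D'uv), E1, E2.
    split; [|now split]. split; [assumption|].
    (* A value between two values of [nu] is attained by [nu]. *)
    intros t Ht E.
    destruct (domain_value_separates D' nu t hD') as [S|S].
    + intros x y Dxy. apply smooth2_continuity with (1 := snu). now apply hsub.
    + intros x y Dxy En. apply (EF x y Dxy). now rewrite En.
    + assert (S1 := S u v D'uv). assert (S2 := S u0 v0 D0).
      revert Ht. unfold Rmax. destruct (Rle_dec (nu u v) (nu u0 v0)); lra.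
    + assert (S1 := S u v D'uv). assert (S2 := S u0 v0 D0).
      revert Ht. unfold Rmin. destruct (Rle_dec (nu u v) (nu u0 v0)); lra.
Qed.

(** * The parallel surface as a space-like surface *)

Lemma parallel_spacelike_surface (D D' : R * R -> Prop) (z l : R -> R -> R31)
    (I : R -> Prop) (f g : R -> R) (nu : R -> R -> R) (a : R) :
  open D -> spacelike_surface z l D -> principal_parameters z l D ->
  W_structure z l D I f g nu -> is_domain D' ->
  (forall u v, D' (u, v) -> D (u, v) /\ parallel_factor z l a u v <> 0) ->
  spacelike_surface (parallel_surface z l a) (parallel_normal z l a) D'.
Proof.
  intros oD hS hP hW hD' hsub.
  destruct (parallel_sign_const D D' z l I f g nu a hW hD' hsub) as [e [e2 He]].
  assert (ne : e <> 0) by (intros E; rewrite E in e2; lra).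
  assert (sub : forall u v, D' (u, v) -> D (u, v)) by (intros; now apply hsub).
  assert (hS' := hS). destruct hS' as [sz [sl hS']].
  split; [|split].
  - apply smooth_map_subset with D; trivial.
    now apply smooth_map_parallel_surface.
  - (* The new normal is [e l = l + (e - 1) l] with a constant [e]. *)
    assert (sc : forall h, smooth2 D h ->
        smooth2 D' (fun u v => sign (parallel_factor z l a u v) * h u v)).
    { intros h sh. apply (smooth2_subset D D' h sub) in sh.
      apply smooth2_ext with (fun u v => h u v + (e - 1) * h u v).
      - apply hD'.
      - intros u v D'uv. rewrite He by assumption. ring.
      - apply smooth2_plus_scal; trivial. apply hD'. }
    destruct sl as [l1 [l2 l3]].
    split; [exact (sc _ l1)|split; [exact (sc _ l2)|exact (sc _ l3)]].
  - intros u v D'uv. destruct (hsub u v D'uv) as [Duv nF].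
    destruct (hS' u v Duv) as [hsp [[lu [lv ll]] num]].
    destruct (spacelike_at_pos z u v hsp) as [Epos Gpos].
    destruct (parallel_factor_nz z l a u v nF) as [n1 n2].
    destruct (parallel_first_form D z l a u v oD hS hP Duv) as [HE [HF HG]].
    destruct (parallel_second_form D z l a u v oD hS hP Duv) as [HL [HM HN]].
    rewrite (He u v D'uv) in HL, HN.
    split; [|split].
    + intros x y nxy. rewrite HE, HF, HG.
      assert (P : 0 < (1 - a * nu1 z l u v) ^ 2 * coefE z u v)
        by (apply Rmult_lt_0_compat; [now apply pow2_gt_0|assumption]).
      assert (Q : 0 < (1 - a * nu2 z l u v) ^ 2 * coefG z u v)
        by (apply Rmult_lt_0_compat; [now apply pow2_gt_0|assumption]).
      destruct (Req_dec x 0) as [Hx|Hx].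
      * assert (Hy : y <> 0) by (intros Hy; apply nxy; now rewrite Hx, Hy).
        assert (Y := Rmult_lt_0_compat _ _ Q (pow2_gt_0 y Hy)).
        rewrite Hx. lra.
      * assert (X := Rmult_lt_0_compat _ _ P (pow2_gt_0 x Hx)).
        assert (Y := Rmult_le_pos _ _ (Rlt_le _ _ Q) (pow2_ge_0 y)).
        lra.
    + unfold unit_normal_at, parallel_normal.
      rewrite (Du_parallel_surface D), (Dv_parallel_surface D) by assumption.
      rewrite !mdot_scal_l, !mdot_scal_r, lu, lv, ll, (He u v D'uv).
      split; [ring|split; [ring|]]. replace (e * (e * -1)) with (- e ^ 2) by ring.
      rewrite e2. reflexivity.
    + (* The principal curvatures [e k / (1 - a k)] differ where the original
         ones do. *)
      intros [k [K1 [_ K2]]]. apply num. exists (nu1 z l u v).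
      destruct (hP u v Duv) as [F0 M0]. rewrite F0, M0.
      rewrite HL, HE in K1. rewrite HN, HG in K2.
      assert (E1 : e * nu1 z l u v = k * (1 - a * nu1 z l u v)).
      { apply Rmult_eq_reg_r with ((1 - a * nu1 z l u v) * coefE z u v); [lra|].
        apply Rmult_integral_contrapositive_currified; lra. }
      assert (E2 : e * nu2 z l u v = k * (1 - a * nu2 z l u v)).
      { apply Rmult_eq_reg_r with ((1 - a * nu2 z l u v) * coefG z u v); [lra|].
        apply Rmult_integral_contrapositive_currified; lra. }
      assert (E : nu2 z l u v = nu1 z l u v).
      { destruct (Req_dec (e + k * a) 0) as [E0|E0].
        - assert (K0 : k = (e + k * a) * nu1 z l u v) by lra.
          rewrite E0, Rmult_0_l in K0. rewrite K0 in E0. lra.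
        - apply Rmult_eq_reg_l with (2 := E0). lra. }
      split; [|split; [ring|rewrite <- E]].
      * unfold nu1. field. lra.
      * unfold nu2. field. lra.
Qed.

Theorem proposition4p1
  (D : R * R -> Prop) (z l : R -> R -> R31)
  (I : R -> Prop) (f g : R -> R) (nu : R -> R -> R) (x0 : R)
  (hD : is_domain D)
  (hS : spacelike_surface z l D)
  (hW : W_structure z l D I f g nu)
  (hx0 : I x0)
  (hnat : natural_principal_parameters z l D f g nu x0)
  (a : R) (ha : a <> 0)
  (D' : R * R -> Prop)
  (hD' : is_domain D')
  (hsub : forall u v, D' (u, v) -> D (u, v) /\ parallel_factor z l a u v <> 0) :
  spacelike_surface (parallel_surface z l a) (parallel_normal z l a) D' /\
  principal_parameters (parallel_surface z l a) (parallel_normal z l a) D' /\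
  W_surface (parallel_surface z l a) (parallel_normal z l a) D' /\
  (forall (I' : R -> Prop) (f' g' : R -> R) (nu' : R -> R -> R) (x0' : R),
     W_structure (parallel_surface z l a) (parallel_normal z l a) D' I' f' g' nu' ->
     I' x0' ->
     natural_principal_parameters (parallel_surface z l a) (parallel_normal z l a)
       D' f' g' nu' x0').
Proof.
  destruct hnat as [hP [[cE HcE] [cG HcG]]].
  assert (oD := proj1 hD). assert (oD' := proj1 hD').
  assert (hP' : principal_parameters (parallel_surface z l a)
                  (parallel_normal z l a) D').
  { intros u v D'uv. destruct (hsub u v D'uv) as [Duv _]. split.
    - now apply (parallel_first_form D z l a u v oD hS hP Duv).
    - now apply (parallel_second_form D z l a u v oD hS hP Duv). }
  split; [|split; [exact hP'|split]].
  { now apply (parallel_spacelike_surface D D' z l I f g nu a). }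
  { now apply (parallel_W_surface D D' z l I f g nu a). }
  intros I' f' g' nu' x0' hW' hx0'.
  destruct (parallel_sign_const D D' z l I f g nu a hW hD' hsub) as [e [e2 He]].
  assert (ne : e <> 0) by (intros E; rewrite E in e2; lra).
  assert (wf := W_structure_W_functions _ _ _ _ _ _ _ _ hW hx0).
  assert (wf' := W_structure_W_functions _ _ _ _ _ _ _ _ hW' hx0').
  destruct hW as [_ [_ [_ [_ [snu H]]]]].
  destruct hW' as [_ [_ [_ [_ [snu' H']]]]].
  assert (rel : forall u v, D' (u, v) ->
      (I (nu u v) /\ I' (nu' u v)) /\
      (f' (nu' u v) = parallel_curvature e a f (nu u v) /\
       g' (nu' u v) = parallel_curvature e a g (nu u v)) /\
      (1 - a * f (nu u v) <> 0 /\ 1 - a * g (nu u v) <> 0) /\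
      (coefE (parallel_surface z l a) u v
         = (1 - a * f (nu u v)) ^ 2 * coefE z u v /\
       coefG (parallel_surface z l a) u v
         = (1 - a * g (nu u v)) ^ 2 * coefG z u v)).
  { intros u v D'uv. destruct (hsub u v D'uv) as [Duv nF].
    destruct (H u v Duv) as [Inu [E1 E2]].
    destruct (H' u v D'uv) as [Inu' [E1' E2']].
    destruct (parallel_first_form D z l a u v oD hS hP Duv) as [HE [_ HG]].
    destruct (parallel_factor_nz z l a u v nF) as [n1 n2].
    destruct (parallel_principal_curvatures D z l a u v oD hS hP Duv nF)
      as [P1 P2].
    rewrite P1, He, E1 in E1' by assumption.
    rewrite P2, He, E2 in E2' by assumption.
    rewrite E1 in HE, n1. rewrite E2 in HG, n2.
    unfold parallel_curvature. auto. }
  split; [exact hP'|split].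
  - apply (zero_partials_const D' (fun u v =>
      sqrt (coefE (parallel_surface z l a) u v) * exp (intI f' g' x0' (nu' u v))) hD');
      intros u v D'uv; destruct (hsub u v D'uv) as [Duv _];
      destruct (rel u v D'uv) as [[_ Iuv'] [[_ Eg] [[nf ng] _]]].
    + apply (parallel_weight_derive I I' f g f' g' (fun t => nu t v)
        (fun t => nu' t v) (fun t => coefE z t v)
        (fun t => coefE (parallel_surface z l a) t v) x0 x0' e a cE u); trivial.
      * now apply smooth2_ex_derive_u with D.
      * now apply smooth2_ex_derive_u with D'.
      * apply filter_imp with (2 := open_locally_u D' u v oD' D'uv).
        intros t Dt. destruct (rel t v Dt) as [[? _] [[? _] [_ [? _]]]].
        assert (c := HcE t v (proj1 (hsub t v Dt))). auto.
    + apply (parallel_weight_derive I I' f g f' g' (fun t => nu u t)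
        (fun t => nu' u t) (fun t => coefE z u t)
        (fun t => coefE (parallel_surface z l a) u t) x0 x0' e a cE v); trivial.
      * now apply smooth2_ex_derive_v with D.
      * now apply smooth2_ex_derive_v with D'.
      * apply filter_imp with (2 := open_locally_v D' u v oD' D'uv).
        intros t Dt. destruct (rel u t Dt) as [[? _] [[? _] [_ [? _]]]].
        assert (c := HcE u t (proj1 (hsub u t Dt))). auto.
  - (* The second function is the first one with the roles of [f] and [g]
       exchanged, since [intJ f g] is [intI g f]. *)
    apply W_functions_sym in wf. apply W_functions_sym in wf'.
    apply (zero_partials_const D' (fun u v =>
      sqrt (coefG (parallel_surface z l a) u v) * exp (intI g' f' x0' (nu' u v))) hD');
      intros u v D'uv; destruct (hsub u v D'uv) as [Duv _];
      destruct (rel u v D'uv) as [[_ Iuv'] [[Ef _] [[nf ng] _]]].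
    + apply (parallel_weight_derive I I' g f g' f' (fun t => nu t v)
        (fun t => nu' t v) (fun t => coefG z t v)
        (fun t => coefG (parallel_surface z l a) t v) x0 x0' e a cG u); trivial.
      * now apply smooth2_ex_derive_u with D.
      * now apply smooth2_ex_derive_u with D'.
      * apply filter_imp with (2 := open_locally_u D' u v oD' D'uv).
        intros t Dt. destruct (rel t v Dt) as [[? _] [[_ ?] [_ [_ ?]]]].
        assert (c := HcG t v (proj1 (hsub t v Dt))). auto.
    + apply (parallel_weight_derive I I' g f g' f' (fun t => nu u t)
        (fun t => nu' u t) (fun t => coefG z u t)
        (fun t => coefG (parallel_surface z l a) u t) x0 x0' e a cG v); trivial.
      * now apply smooth2_ex_derive_v with D.
      * now apply smooth2_ex_derive_v with D'.
      * apply filter_imp with (2 := open_locally_v D' u v oD' D'uv).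
        intros t Dt. destruct (rel u t Dt) as [[? _] [[_ ?] [_ [_ ?]]]].
        assert (c := HcG u t (proj1 (hsub u t Dt))). auto.
Qed.
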